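(* Let $W=\mathfrak S_n$ with simple reflections $s_1,\ldots,s_{n-1}$, where $s_i$ is the adjacent transposition $(i\ i{+}1)$, and let $J=\{s_j,s_{j+1},\ldots,s_{n-1}\}$ for some $1\le j\le n$ (so $J=\emptyset$ if $j=n$). Let $w\in W^J$ be $J$-rationally smooth. Then $[e,w]^J$ admits a Lehmer code.
   Context: $W_J$ is the subgroup generated by $J$, $W^J$ is the set of minimal-length representatives of the cosets $W/W_J$, $\le$ is Bruhat order, $\ell$ is length, and $[e,w]^J=\{v\in W^J\mid v\le w\}$, with the order induced from Bruhat order and ranked by length. An element $w\in W^J$ is $J$-rationally smooth if the parabolic Kazhdan--Lusztig polynomial $P^J_{e,w}(q)$ equals $1$; equivalently, if $\mathcal P^J(w)=\sum_{v\in[e,w]^J}q^{\ell(v)}$ is palindromic, i.e. $q^{\ell(w)}\mathcal P^J(w)(q^{-1})=\mathcal P^J(w)(q)$. Let $C_a$ denote the chain (totally ordered set) of cardinality $a$. A ranked poset $P$ admits a Lehmer code if there is an order- and rank-preserving bijection $L:C_{a_1}\times\cdots\times C_{a_k}\to P$ for some $a_1,\ldots,a_k\in\mathbb N$ (the product of chains has the componentwise order; the inverse of $L$ is not required to be order-preserving). *)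

(* Defs.v *)
From mathcomp Require Import all_boot all_fingroup all_algebra.

Set Implicit Arguments.
Unset Strict Implicit.
Unset Printing Implicit Defensive.

Import GroupScope GRing.Theory.

(* The letters 1, ..., n are the ordinals 0, ..., n-1 of 'I_n, so s_i is the
   transposition of the ordinals i-1 and i, and the set below is
   {s_j, ..., s_{n-1}} for 1 <= j.  The product of 'S_n composes from left to
   right; since w |-> w^-1 is an isomorphism onto the opposite group fixing
   every s_i, the notions below, which only involve the Coxeter system, do not
   depend on this choice. *)
Definition simple_from (n j : nat) : {set 'S_n} :=
  [set t | [exists i : 'I_n, exists k : 'I_n,
     [&& k == i.+1 :> nat, j <= k & t == tperm i k]]].

Definition simple (n : nat) : {set 'S_n} := simple_from n 1.

Lemma tperm_simple_gen n (i k : 'I_n) : tperm i k \in <<simple n>>.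
Proof.
wlog le_ik : i k / i <= k.
  move=> H; case: (leqP i k) => [|/ltnW] le_ik; first exact: H.
  by rewrite tpermC; exact: H.
have [d] := ubnP (k - i); elim: d => // d IH in k le_ik *.
rewrite ltnS leq_eqVlt => /orP[/eqP dE|]; last exact: IH.
have [->|ne_ik] := eqVneq i k; first by rewrite tperm1 group1.
have lt_ik : i < k by rewrite ltn_neqAle le_ik andbT; exact: ne_ik.
have k'n : k.-1 < n by apply: leq_ltn_trans (ltn_ord k); exact: leq_pred.
pose k' := Ordinal k'n.
have k'S : k = k'.+1 :> nat by rewrite /= prednK // (leq_ltn_trans _ lt_ik).
have sk : tperm k' k \in <<simple n>>.
  apply: mem_gen; rewrite inE; apply/existsP; exists k'; apply/existsP.
  by exists k; rewrite k'S !eqxx.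
have [eik'|ne_ik'] := eqVneq i k'; first by rewrite eik'.
have le_ik' : i <= k' by rewrite -ltnS -k'S.
have := IH k' le_ik'; rewrite -dE k'S subSn // ltnSn => /(_ isT) ik'.
rewrite -(_ : tperm i k' ^ tperm k' k = tperm i k) ?groupJ //.
by rewrite tpermJ tpermL tpermD // eq_sym.
Qed.

Lemma simple_word n (w : 'S_n) : exists k, w \in simple n ^+ k.
Proof.
have /gen_prodgP[k [c cS ->]] : w \in <<simple n>>.
  have [ts -> _] := prod_tpermP w.
  by apply: group_prod => t _; exact: tperm_simple_gen.
exists k; elim: k => [|k IH] in c cS *.
  by rewrite big_ord0 expg0; exact: set11.
by rewrite big_ord_recl expgS mem_mulg ?cS // IH.
Qed.

(* [simple n ^+ k] is the set of products of k simple reflections. *)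
Definition len n (w : 'S_n) : nat := ex_minn (simple_word w).

Definition reflections n : {set 'S_n} := class_support (simple n) [set: 'S_n].

Definition bruhat n : rel 'S_n :=
  connect [rel u v : 'S_n | (u^-1 * v \in reflections n) && (len u < len v)].

(* W^J: shortest elements of the cosets w W_J. *)
Definition min_reps n (J : {set 'S_n}) : {set 'S_n} :=
  [set w | [forall u in <<J>>, len w <= len (w * u)]].

Definition lower_interval n (J : {set 'S_n}) (w : 'S_n) : {set 'S_n} :=
  [set v in min_reps J | bruhat v w].

Definition poincare n (J : {set 'S_n}) (w : 'S_n) : {poly int} :=
  (\sum_(v in lower_interval J w) 'X^(len v))%R.

(* q ^ d * p (q^-1), for p of degree at most d. *)
Definition rev_poly (d : nat) (p : {poly int}) : {poly int} :=
  (\poly_(i < d.+1) p`_(d - i))%R.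

(* Palindromicity of the Poincare polynomial, which for w in W^J is equivalent
   to P^J_{e,w} = 1 (parabolic Kazhdan-Lusztig polynomials of type x = -1).
   [rev_poly] does not truncate, as v <= w implies len v <= len w. *)
Definition rationally_smooth n (J : {set 'S_n}) (w : 'S_n) : Prop :=
  rev_poly (len w) (poincare J w) = poincare J w.

(* [P] is a poset under [le], ranked by [rk]; C_a is 'I_a, so the product of
   chains is ranked by the sum of the coordinates. *)
Definition admits_lehmer_code (T : finType) (P : {set T}) (le : rel T)
    (rk : T -> nat) : Prop :=
  exists (k : nat) (a : 'I_k -> nat)
    (L : {dffun forall i : 'I_k, 'I_(a i)} -> T),
    [/\ injective L,
        L @: [set: {dffun forall i : 'I_k, 'I_(a i)}] = P,
        forall x y : {dffun forall i : 'I_k, 'I_(a i)},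
          (forall i, x i <= y i) -> le (L x) (L y)
      & forall x, rk (L x) = \sum_(i < k) x i].

(* Main.v *)
(* Bruhat order on S_n is the reversed pointwise order on the counts
   #{l < p : v l < m}.  Given x <= w, the number [nedges w x] of transpositions
   t with t x <= w does not increase along covers (inspect the cosets of the
   copies of S_3), so it is at least the length of w (Deodhar's inequality).
   Palindromicity means that lengths in the interval average to half the length
   of w; counting the edges of the Bruhat graph, [nedges] averages to the
   length of w, hence equals it everywhere, in particular at the identity.  For
   the longest element w of the coset, this equality forces, by induction on n
   removing the first letter, that the values at most w(0) appear in decreasing
   order, or the same for w^-1.  Then deleting the first letter (resp. the value
   0) identifies the interval with a chain times an interval in S_{n-1} of the
   same kind, and the reinsertion map preserves order and adds lengths.

   Because the product of 'S_n composes from left to right, the one-line words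
   are those of the inverses: v is in W^J iff v^-1 increases on the positions
   from j - 1 on. *)

Require Import Defs.
From mathcomp Require Import all_boot all_fingroup all_algebra.
From mathcomp Require Import zify.

Set Implicit Arguments.
Unset Strict Implicit.
Unset Printing Implicit Defensive.

Import GRing.Theory.

(** * Counts and Bruhat order *)

Definition cnt n (v : 'S_n) (p m : nat) : nat :=
  \sum_(l < n) ((l < p) && (v l < m)).

Definition dle n (u v : 'S_n) : Prop := forall p m, cnt v p m <= cnt u p m.

Lemma sum_ord_lt n p : \sum_(l < n) (l < p) = minn p n.
Proof.
elim: n => [|n IH]; first by rewrite big_ord0 minn0.
by rewrite big_ord_recr /= IH; case: ltnP => /=; lia.
Qed.

Lemma sum_perm_lt n (v : 'S_n) m : \sum_(l < n) (v l < m) = minn m n.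
Proof. by rewrite -sum_ord_lt [RHS](reindex_inj (@perm_inj _ v)). Qed.

Lemma cntV n (v : 'S_n) p m : cnt v^-1%g p m = cnt v m p.
Proof.
rewrite /cnt (reindex_inj (@perm_inj _ v)) /=.
by apply: eq_bigr => l _; rewrite permK andbC.
Qed.

Lemma dleV n (u v : 'S_n) : dle u^-1%g v^-1%g <-> dle u v.
Proof. by split=> H p m; [have := H m p; rewrite !cntV | rewrite !cntV]. Qed.

Lemma dle_refl n (u : 'S_n) : dle u u. Proof. by []. Qed.

Lemma dle_trans n (v u w : 'S_n) : dle u v -> dle v w -> dle u w.
Proof. by move=> uv vw p m; apply: leq_trans (vw p m) (uv p m). Qed.

Lemma cntS n (v : 'S_n) (i : 'I_n) m : cnt v i.+1 m = cnt v i m + (v i < m).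
Proof.
rewrite /cnt (bigD1 i) //= [in RHS](bigD1 i) //= ltnSn ltnn add0n addnC.
congr (_ + _); apply: eq_bigr => l; rewrite -val_eqE /= => ne.
by rewrite ltnS leq_eqVlt (negbTE ne).
Qed.

Lemma dle_anti n (u v : 'S_n) : dle u v -> dle v u -> u = v.
Proof.
move=> uv vu; have E p m : cnt u p m = cnt v p m.
  by apply/eqP; rewrite eqn_leq uv vu.
apply/permP => i; apply/val_inj/eqP => /=.
have H m : (u i < m) = (v i < m).
  by have := cntS u i m; rewrite !E cntS => /addnI; do 2!case: (_ < m).
by have := H (v i); have := H (u i); rewrite !ltnn; case: ltngtP.
Qed.

(** Products compose from left to right, so [tperm a b * v] exchanges the values at positions [a]
    and [b]. Only the rectangle between the two points loses one from its counts. *)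
Lemma cnt_swap n (v : 'S_n) (a b : 'I_n) p m : a < b -> v a < v b ->
  cnt (tperm a b * v)%g p m + ((a < p <= b) && (v a < m <= v b)) = cnt v p m.
Proof.
move=> ab vab; have ne : b != a by rewrite neq_ltn ab orbT.
rewrite /cnt (bigD1 a) //= (bigD1 b) //= [in RHS](bigD1 a) //=.
rewrite [in RHS](bigD1 b) //= !permM tpermL tpermR.
rewrite (eq_bigr (fun l : 'I_n => ((l < p) && (v l < m)) : nat)); last first.
  by move=> l /andP[la lb]; rewrite permM tpermD // eq_sym.
by lia.
Qed.

Lemma dle_swap n (v : 'S_n) (a b : 'I_n) : a < b -> v a < v b ->
  dle v (tperm a b * v)%g.
Proof. by move=> ab vab p m; rewrite -(cnt_swap p m ab vab) leq_addr. Qed.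

Lemma dle_unswap n (v : 'S_n) (a b : 'I_n) : a < b -> v b < v a ->
  dle (tperm a b * v)%g v.
Proof.
move=> ab vba; have := @dle_swap n (tperm a b * v)%g a b ab.
by rewrite !permM tpermL tpermR mulgA tperm2 mul1g; apply.
Qed.

(* i is the first position where x and w differ, j the next one with
   [x i < x j <= w i]. *)
Lemma exists_cover n (x w : 'S_n) : dle x w -> x <> w ->
  exists i j : 'I_n, [/\ i < j, x i < x j,
    forall l : 'I_n, i < l < j -> ~~ (x i < x l < x j) &
    dle (tperm i j * x)%g w].
Proof.
move=> xw xNw.
have [i0 i0P] : exists i, x i != w i.
  apply/existsP; apply: contraPT xNw => /existsPn H.
  by apply; apply/permP => i; apply/eqP; have := H i; rewrite negbK.
case: (arg_minnP (P := fun i => x i != w i) (fun i : 'I_n => i : nat) i0P) => i iP imin.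
have agree (l : 'I_n) : l < i -> x l = w l.
  by move=> li; apply/eqP; apply: contraLR li => /imin; rewrite -leqNgt.
have cagree m : cnt x i m = cnt w i m.
  by apply: eq_bigr => l _; case: ltnP => // /agree ->.
have xi_lt : x i < w i.
  rewrite ltn_neqAle; apply/andP; split; first exact: iP.
  have := xw i.+1 (w i).+1; rewrite !cntS cagree leq_add2l ltnSn.
  by lia.
have j0P : (i < (x^-1)%g (w i)) && (x i < x ((x^-1)%g (w i)) <= w i).
  rewrite permKV xi_lt leqnn !andbT; case: ltngtP => // [lti|eqi].
    have := agree _ lti; rewrite permKV => /perm_inj e.
    by move: lti; rewrite -e ltnn.
  by move: xi_lt; rewrite {1}(val_inj eqi) permKV ltnn.
case: (arg_minnP (P := fun j : 'I_n => (i < j) && (x i < x j <= w i))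
         (fun j : 'I_n => j : nat) j0P) => j /and3P[ij xij xjw] jmin.
exists i, j; split=> //.
  move=> l /andP[il lj]; apply/negP => /andP[xil xlj].
  have := jmin l; rewrite il xil (leq_trans (ltnW xlj) xjw) => /(_ isT).
  by rewrite leqNgt lj.
move=> p m; have := cnt_swap p m ij xij.
case: andP => [[/andP[ip pj] /andP[xim mxj]]|_]; last by rewrite addn0 => ->.
(* Inside the rectangle the swap costs one, so a strict gap is needed. By the choice of [j], the
   values of [x] strictly between positions [i] and [p] avoid []x i, w i]]. Raising [m] to
   [(w i).+1] thus adds nothing to [x] from [i] on, while [w] gains position [i]. *)
suff: cnt w p m < cnt x p m by lia.
have Ex : cnt x p m + cnt x i (w i).+1 = cnt x p (w i).+1 + cnt x i m.
  rewrite /cnt -!big_split /=; apply: eq_bigr => l _.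
  have [ll|ll] := ltnP l i; first by lia.
  case: ltnP => lp; last by rewrite ?andbF.
  have [eli|neli] := eqVneq l i; first by rewrite eli; lia.
  have il : i < l by rewrite ltn_neqAle ll eq_sym neli.
  have := jmin l; rewrite il /= => H; have {}H : ~~ (x i < x l <= w i).
    by apply/negP => /H; rewrite leqNgt (leq_trans lp pj).
  by lia.
have Ew : cnt w p m + cnt w i (w i).+1 + 1 <= cnt w p (w i).+1 + cnt w i m.
  have -> : 1 = \sum_(l < n) (l == i) by rewrite (bigD1 i) //= eqxx big1 // => l /negbTE ->.
  rewrite /cnt -!big_split /=; apply: leq_sum => l _.
  have [->|ne] := eqVneq l i; first by lia.
  by lia.
have := xw p (w i).+1; have := cagree m; have := cagree (w i).+1; lia.
Qed.

(** * Sums over pairs of positions and the number of inversions *)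

Definition pair_sum n (F : 'I_n -> 'I_n -> nat) : nat :=
  \sum_(a < n) \sum_(b < n) (a < b) * F a b.

Lemma eq_pair_sum n (F G : 'I_n -> 'I_n -> nat) :
  (forall a b : 'I_n, a < b -> F a b = G a b) -> pair_sum F = pair_sum G.
Proof.
move=> FG; apply: eq_bigr => a _; apply: eq_bigr => b _.
by case: ltnP => // /FG ->.
Qed.

Lemma leq_pair_sum n (F G : 'I_n -> 'I_n -> nat) :
  (forall a b : 'I_n, a < b -> F a b <= G a b) -> pair_sum F <= pair_sum G.
Proof.
move=> FG; apply: leq_sum => a _; apply: leq_sum => b _.
by case: ltnP => // /FG; rewrite !mul1n.
Qed.

Lemma pair_sum_sym n (F : 'I_n -> 'I_n -> nat) : (forall a b, F a b = F b a) ->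
  pair_sum F + pair_sum F = \sum_(a < n) \sum_(b < n | b != a) F a b.
Proof.
move=> sF; rewrite {2}/pair_sum exchange_big -big_split /=.
apply: eq_bigr => a _; rewrite -big_split /= [RHS]big_mkcond /=.
apply: eq_bigr => b _; rewrite [F b a]sF -mulnDl -val_eqE /=.
by case: ltngtP => _; rewrite ?mul1n ?mul0n.
Qed.

(** Doubling replaces [a < b] by [a != b], so pairs can be grouped by how they meet [{i, j}],
    whatever the order of their entries. *)
Lemma pair_sum_split n (F : 'I_n -> 'I_n -> nat) (i j : 'I_n) :
  (forall a b, F a b = F b a) -> i != j ->
  pair_sum F + pair_sum F =
    F i j + F i j + \sum_(l | (l != i) && (l != j)) (F i l + F j l)
    + \sum_(l | (l != i) && (l != j)) (F i l + F j l)
    + \sum_(a | (a != i) && (a != j)) \sum_(b | [&& b != a, b != i & b != j]) F a b.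
Proof.
move=> sF ne; rewrite pair_sum_sym //.
have Ei : \sum_(b | b != i) F i b = F i j + \sum_(l | (l != i) && (l != j)) F i l.
  by rewrite (bigD1 j) // eq_sym.
have Ej : \sum_(b | b != j) F j b = F i j + \sum_(l | (l != i) && (l != j)) F j l.
  by rewrite (bigD1 i) //= sF; congr (_ + _); apply: eq_bigl => l; rewrite andbC.
have Ea (a : 'I_n) : (a != i) && (a != j) -> \sum_(b | b != a) F a b =
    F i a + F j a + \sum_(b | [&& b != a, b != i & b != j]) F a b.
  case/andP=> ai aj; rewrite (bigD1 i) 1?eq_sym //= (bigD1 j) /=; last first.
    by rewrite !(eq_sym j) aj ne.
  rewrite addnA [F i a]sF [F j a]sF; congr (_ + _).
  by apply: eq_bigl => b; rewrite andbA.
rewrite (bigD1 i) //= [X in _ + X = _](bigD1 j) 1?eq_sym //= Ei Ej (eq_bigr _ Ea) !big_split /=.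
by rewrite addnA [X in X + _ = _]addnACA addnA.
Qed.

Lemma pair_sum_swap_le n (F G : 'I_n -> 'I_n -> nat) (i j : 'I_n) :
  (forall a b, F a b = F b a) -> (forall a b, G a b = G b a) -> i != j ->
  F i j <= G i j ->
  (forall l, l != i -> l != j -> F i l + F j l <= G i l + G j l) ->
  (forall a b, a != i -> a != j -> b != i -> b != j -> a != b -> F a b <= G a b) ->
  pair_sum F <= pair_sum G.
Proof.
move=> sF sG ne Hij Hl Hab; rewrite -leq_double -!addnn.
rewrite (pair_sum_split sF ne) (pair_sum_split sG ne).
have H1 : \sum_(l | (l != i) && (l != j)) (F i l + F j l) <=
          \sum_(l | (l != i) && (l != j)) (G i l + G j l).
  by apply: leq_sum => l /andP[]; exact: Hl.
apply: leq_add; first by rewrite !leq_add.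
apply: leq_sum => a /andP[ai aj]; apply: leq_sum => b /and3P[ba bi bj].
by rewrite Hab // eq_sym.
Qed.

Definition ninv n (v : 'S_n) : nat := pair_sum (fun a b => v b < v a).

(** The inversion indicator made symmetric in [a] and [b], as [pair_sum_split] requires. *)
Definition flipped n (v : 'S_n) (a b : 'I_n) : nat := (a < b) (+) (v a < v b).

Lemma flippedC n (v : 'S_n) a b : flipped v a b = flipped v b a.
Proof.
rewrite /flipped; have [->//|ne] := eqVneq a b.
have : v a != v b by rewrite (inj_eq perm_inj).
by rewrite -!val_eqE /= in ne *; lia.
Qed.

Lemma invE n (v : 'S_n) : ninv v = pair_sum (flipped v).
Proof.
apply: eq_pair_sum => a b ab; rewrite /flipped ab /=.
have : v a != v b by rewrite (inj_eq perm_inj) neq_ltn ab.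
by rewrite -val_eqE /=; lia.
Qed.

Lemma invV n (v : 'S_n) : ninv v^-1%g = ninv v.
Proof.
rewrite !invE; apply/double_inj; rewrite -!addnn !pair_sum_sym; [|exact: flippedC..].
rewrite [LHS](reindex_inj (@perm_inj _ v)) /=; apply: eq_bigr => a _.
rewrite [LHS](reindex_inj (@perm_inj _ v)) /=; apply: eq_big => b.
  by rewrite (inj_eq perm_inj).
by rewrite /flipped !permK addbC.
Qed.

(** As no point lies strictly inside the rectangle, every third position has as many inversions with
    [{i, j}] after the swap as before; only the pair [(i, j)] itself changes. *)
Lemma inv_cover n (x : 'S_n) (i j : 'I_n) : i < j -> x i < x j ->
  (forall l : 'I_n, i < l < j -> ~~ (x i < x l < x j)) ->
  ninv (tperm i j * x)%g = (ninv x).+1.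
Proof.
move=> ij xij cov; have ne : i != j by rewrite neq_ltn ij.
set x' := (tperm i j * x)%g; rewrite !invE.
have x'i : x' i = x j by rewrite permM tpermL.
have x'j : x' j = x i by rewrite permM tpermR.
have x'D l : l != i -> l != j -> x' l = x l.
  by move=> li lj; rewrite permM tpermD // eq_sym.
suff : pair_sum (flipped x') + pair_sum (flipped x') =
  2 + (pair_sum (flipped x) + pair_sum (flipped x)) by lia.
rewrite (pair_sum_split (flippedC x') ne) (pair_sum_split (flippedC x) ne).
have -> : flipped x' i j = 1 by rewrite /flipped x'i x'j; lia.
have -> : flipped x i j = 0 by rewrite /flipped; lia.
rewrite (eq_bigr (fun l => flipped x i l + flipped x j l)); last first.
  move=> l /andP[li lj]; rewrite /flipped x'i x'j x'D //.
  have xli : x l != x i by rewrite (inj_eq perm_inj).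
  have xlj : x l != x j by rewrite (inj_eq perm_inj).
  have := cov l; move: li lj xli xlj; rewrite -!val_eqE /=.
  by lia.
rewrite [X in _ + X = _](eq_bigr (fun a =>
  \sum_(b | [&& b != a, b != i & b != j]) flipped x a b)); first by rewrite add0n !addnA.
move=> a /andP[ai aj]; apply: eq_bigr => b /and3P[ba bi bj].
by rewrite /flipped !x'D.
Qed.

Lemma inv_bound n (v : 'S_n) : ninv v <= n * n.
Proof.
have -> : n * n = \sum_(a < n) \sum_(b < n) 1.
  by rewrite sum_nat_const sum1_card card_ord.
by apply: leq_sum => a _; apply: leq_sum => b _; do 2!case: (_ < _).
Qed.

(** Descending induction from [w]: [exists_cover] gives the step up, and the crude bound [n * n] on
    inversions makes it terminate. *)
Lemma dle_ind n (w : 'S_n) (Q : 'S_n -> Prop) : Q w ->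
  (forall (x : 'S_n) (i j : 'I_n), i < j -> x i < x j ->
     ninv (tperm i j * x)%g = (ninv x).+1 ->
     dle (tperm i j * x)%g w -> Q (tperm i j * x)%g -> Q x) ->
  forall x, dle x w -> Q x.
Proof.
move=> Qw step x; have [d] := ubnP (n * n - ninv x).
elim: d x => // d IH x lt_d xw; have [->//|/eqP ne] := eqVneq x w.
have [i [j [ij xij cov x'w]]] := exists_cover xw ne.
have ix := inv_cover ij xij cov; have := inv_bound (tperm i j * x)%g.
rewrite ix => bx; apply: (step x i j) => //; apply: IH => //.
by rewrite ix; lia.
Qed.

Lemma dle_inv n (x w : 'S_n) : dle x w -> ninv x <= ninv w.
Proof. by move: x; apply: dle_ind => // x i j _ _ -> _ /ltnW. Qed.

(** * Permutations monotone on a tail of positions *)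

Definition tail_inc n k (v : 'S_n) : Prop :=
  forall a b : 'I_n, k <= a -> a < b -> v a < v b.

Definition tail_dec n k (v : 'S_n) : Prop :=
  forall a b : 'I_n, k <= a -> a < b -> v b < v a.

Lemma cnt_prefix_out n (v : 'S_n) p m : n <= p -> cnt v p m = minn m n.
Proof.
move=> np; rewrite -(sum_perm_lt v); apply: eq_bigr => l _.
by rewrite (leq_trans (ltn_ord l) np).
Qed.

(** An increasing tail makes the counts beyond [k] as large as those at [k] allow: either all values
    at positions [k] to [p.-1] are below [m], or every value below [m] has occurred before [p]. *)
Lemma tail_inc_dle n k (v w : 'S_n) : tail_inc k v ->
  (forall p m, p <= k -> cnt w p m <= cnt v p m) -> dle v w.
Proof.
move=> vinc H p m; have [/H//|kp] := leqP p k.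
have [np|pn] := leqP n p; first by rewrite !cnt_prefix_out.
have p0 : p.-1 < n by lia.
pose i := Ordinal p0.
have [vi|vi] := ltnP (v i) m.
  have E : cnt v p m = cnt v k m + \sum_(l < n) (k <= l < p).
    rewrite /cnt -big_split; apply: eq_bigr => l _ /=.
    have [lk|kl] := ltnP l k; first by lia.
    have [lp|] := ltnP l p => //; rewrite /= (leq_trans _ vi) // ltnS.
    have [->//|ne] := eqVneq l i; apply/ltnW/vinc => //.
    by move: ne; rewrite -val_eqE /=; lia.
  rewrite E (leq_trans _ (leq_add (H k m (leqnn k)) (leqnn _))) //.
  rewrite /cnt -big_split; apply: leq_sum => l _ /=.
  by lia.
have -> : cnt v p m = minn m n.
  rewrite -(sum_perm_lt v); apply: eq_bigr => l _.
  have [//|lp] := ltnP l p; rewrite andFb ltnNge (_ : m <= v l) //.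
  rewrite (leq_trans vi) // ltnW //; apply: vinc => /=; lia.
by rewrite -(sum_perm_lt w); apply: leq_sum => l _; lia.
Qed.

(** Dually, a decreasing tail makes the counts as small as possible: either all values from [p] on
    are below [m], or none of those at positions [k] to [p.-1] is. *)
Lemma tail_dec_dle n k (v w : 'S_n) : tail_dec k w ->
  (forall p m, p <= k -> cnt w p m <= cnt v p m) -> dle v w.
Proof.
move=> wdec H p m; have [/H//|kp] := leqP p k.
have [np|pn] := leqP n p; first by rewrite !cnt_prefix_out.
have p0 : p.-1 < n by lia.
pose i := Ordinal p0.
have [wi|wi] := ltnP (w i) m.
  have E : cnt w p m + \sum_(l < n) (p <= l) = minn m n.
    rewrite -(sum_perm_lt w) /cnt -big_split /=; apply: eq_bigr => l _.
    have [//|pl] := ltnP l p; first by rewrite addn0.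
    rewrite (ltn_trans _ wi) //; apply: wdec => /=; lia.
  rewrite -(leq_add2r (\sum_(l < n) (p <= l))) E -(sum_perm_lt v) /cnt -big_split.
  by apply: leq_sum => l _ /=; lia.
have E : cnt w p m = cnt w k m.
  apply: eq_bigr => l _.
  have [lk|kl] := ltnP l k; first by lia.
  have [lp|//] := ltnP l p; rewrite ltnNge (leq_trans wi) //.
  have [->//|ne] := eqVneq l i; apply/ltnW/wdec => //.
  by move: ne; rewrite -val_eqE /=; lia.
rewrite E (leq_trans (H k m (leqnn k))) //.
by apply: leq_sum => l _; lia.
Qed.

Lemma dle_1 n (w : 'S_n) : dle 1%g w.
Proof.
apply: (@tail_inc_dle _ 0) => [a b _|p m]; first by rewrite !perm1.
by rewrite leqn0 => /eqP ->; rewrite /cnt big1.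
Qed.

Lemma tail_inc0 n (w : 'S_n) : tail_inc 0 w -> w = 1%g.
Proof.
move=> winc; apply: dle_anti (dle_1 w); apply: (tail_inc_dle winc) => p m.
by rewrite leqn0 => /eqP ->; rewrite /cnt big1.
Qed.

Lemma tail_inc_step n k (v : 'S_n) :
  (forall a b : 'I_n, k <= a -> b = a.+1 :> nat -> v a < v b) -> tail_inc k v.
Proof.
move=> H a b ka; have [d] := ubnP (b - a); elim: d b => // d IH b lt_d ab.
have [/H->//|ne] := eqVneq (nat_of_ord b) a.+1.
have b1 : b.-1 < n by have := ltn_ord b; lia.
apply: (@ltn_trans (v (Ordinal b1))); first by apply: IH => /=; lia.
by apply: H => /=; lia.
Qed.

(** * Length and Bruhat order of the Coxeter system *)

Lemma simple_fromP n j (t : 'S_n) :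
  reflect (exists i k : 'I_n, [/\ k = i.+1 :> nat, j <= k & t = tperm i k])
          (t \in simple_from n j).
Proof.
rewrite inE; apply: (iffP existsP) => [[i /existsP[k /and3P[/eqP ki jk /eqP ->]]]|].
  by exists i, k.
by case=> i [k [ki jk ->]]; exists i; apply/existsP; exists k; rewrite jk ki !eqxx.
Qed.

Lemma inv_asc n (x : 'S_n) (i k : 'I_n) : k = i.+1 :> nat -> x i < x k ->
  ninv (tperm i k * x)%g = (ninv x).+1.
Proof. by move=> ki xik; apply: inv_cover => // [|l]; lia. Qed.

Lemma inv_desc n (x : 'S_n) (i k : 'I_n) : k = i.+1 :> nat -> x k < x i ->
  ninv x = (ninv (tperm i k * x)%g).+1.
Proof.
move=> ki xki; have := @inv_asc n (tperm i k * x)%g i k ki.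
by rewrite !permM tpermL tpermR mulgA tperm2 mul1g; apply.
Qed.

Lemma ninv1 n : ninv (1 : 'S_n)%g = 0.
Proof. by rewrite /ninv /pair_sum big1 // => a _; rewrite big1 // => b _; rewrite !perm1; lia. Qed.

Lemma inv_word n m (w : 'S_n) : w \in (simple n ^+ m)%g -> ninv w <= m.
Proof.
elim: m w => [|m IH] w.
  by rewrite expg0 => /set1P ->; rewrite ninv1.
rewrite expgS => /mulsgP[_ x /simple_fromP[i [k [ki _ ->]]] /IH le_m ->].
have [xik|xki] := ltnP (x i) (x k); first by rewrite inv_asc.
have := @inv_desc n x i k ki; rewrite ltn_neqAle xki andbT val_eqE (inj_eq perm_inj).
by rewrite -val_eqE /= ki neq_ltn ltnSn orbT => /(_ isT) E; rewrite (leq_trans _ (leqW le_m)) // E.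
Qed.

(** Undoing a descent lowers [ninv] by one, and only the identity has no descent. *)
Lemma word_inv n (w : 'S_n) : w \in (simple n ^+ ninv w)%g.
Proof.
have [d] := ubnP (ninv w); elim: d w => // d IH w lt_d.
have [[i k] /= /andP[/eqP ki wki]|none] :=
  pickP [pred u : 'I_n * 'I_n | (u.2 == u.1.+1 :> nat) && (w u.2 < w u.1)].
  have E := inv_desc ki wki.
  rewrite E expgS; apply/mulsgP; exists (tperm i k) (tperm i k * w)%g.
  - by apply/simple_fromP; exists i, k; rewrite ki.
  - by apply: IH; lia.
  - by rewrite mulgA tperm2 mul1g.
suff -> : w = 1%g by rewrite ninv1 expg0; apply/set1P.
apply/tail_inc0/tail_inc_step => a b _ ba.
have := none (a, b); rewrite /= ba eqxx /=; case: ltngtP => // e.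
by have := perm_inj (val_inj e) => eab; move: ba; rewrite eab; lia.
Qed.

Lemma len_inv n (w : 'S_n) : len w = ninv w.
Proof.
rewrite /len; case: ex_minnP => m wm min_m; apply/eqP; rewrite eqn_leq.
by rewrite min_m ?word_inv // inv_word.
Qed.

Lemma reflectionsP n (t : 'S_n) :
  reflect (exists a b : 'I_n, a < b /\ t = tperm a b)
          (t \in reflections n).
Proof.
apply: (iffP imset2P) => [[_ g /simple_fromP[i [k [ki _ ->]]] _ ->]|].
  rewrite tpermJ; have : g i != g k.
    by rewrite (inj_eq perm_inj) -val_eqE /= ki neq_ltn ltnSn.
  rewrite -val_eqE /= neq_ltn => /orP[lt_g|lt_g]; first by exists (g i), (g k).
  by exists (g k), (g i); rewrite tpermC.
case=> a [b [ab ->]]; have a1 : a.+1 < n by apply: leq_ltn_trans (ltn_ord b).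
(* The transposition of [a] and [a + 1], conjugated by that of [a + 1] and [b] (trivial if
   [b = a + 1]), is that of [a] and [b]. *)
pose c := Ordinal a1; exists (tperm a c) (tperm c b).
- by apply/simple_fromP; exists a, c.
- by rewrite inE.
rewrite tpermJ tpermL tpermD //; rewrite -val_eqE /= neq_ltn ?ltnSn ?orbT //.
by rewrite ab orbT.
Qed.

Lemma bruhatP n (u v : 'S_n) : reflect (dle u v) (bruhat u v).
Proof.
apply: (iffP idP) => [/connectP[p]|].
  elim: p u => [|y p IH] u /=; first by move=> _ ->; exact: dle_refl.
  case/andP=> /andP[/reflectionsP[a [b [ab ty]]] lt_uy] yp /(IH y yp); apply: dle_trans.
  (* An edge multiplies by a transposition of values on the right; conjugation turns it into an
     exchange of positions, whose direction the lengths decide. *)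
  have Ey : y = (tperm ((u^-1)%g a) ((u^-1)%g b) * u)%g.
    by rewrite -tpermJ conjgE invgK -ty mulgA mulKVg mulgKV.
  move: lt_uy; rewrite !len_inv Ey; set i := (u^-1)%g a; set k := (u^-1)%g b.
  have uik : u i < u k by rewrite !permKV.
  case: (ltngtP i k) => [ik _|ki|/val_inj eik]; first exact: dle_swap.
    by rewrite tpermC => /leq_trans/(_ (dle_inv (dle_unswap ki uik))); rewrite ltnn.
  by move: uik; rewrite eik ltnn.
move: u; apply: dle_ind => [|x i j ij xij invE _]; first exact: connect0.
apply: connect_trans; apply: connect1; rewrite /= !len_inv invE ltnSn andbT.
apply/reflectionsP; exists (x i), (x j); split=> //.
by rewrite -tpermJ conjgE.
Qed.

(** * Deodhar's inequality *)

Lemma bruhat_trans n (v u w : 'S_n) : bruhat u v -> bruhat v w -> bruhat u w.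
Proof. exact: connect_trans. Qed.

Lemma bruhat_swap n (v : 'S_n) (a b : 'I_n) : a < b -> v a < v b ->
  bruhat v (tperm a b * v)%g.
Proof. by move=> ab vab; apply/bruhatP/dle_swap. Qed.

Lemma bruhat_unswap n (v : 'S_n) (a b : 'I_n) : a < b -> v b < v a ->
  bruhat (tperm a b * v)%g v.
Proof. by move=> ab vba; apply/bruhatP/dle_unswap. Qed.

Lemma bruhat_inv n (u v : 'S_n) : bruhat u v -> ninv u <= ninv v.
Proof. by move/bruhatP/dle_inv. Qed.

(* The two lower bounds on the counts of w from 312 and 231 give that of 321:
   at each prefix, 321 has the same set of values as one of the other two. *)
Lemma bruhat_join n (y u v w : 'S_n) (a b c : 'I_n) :
  a < b -> b < c -> y a < y b -> y b < y c ->
  [/\ u a = y c, u b = y a & u c = y b] ->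
  [/\ v a = y b, v b = y c & v c = y a] ->
  (forall d, d != a -> d != b -> d != c -> u d = y d /\ v d = y d) ->
  bruhat u w -> bruhat v w -> bruhat (tperm a c * y)%g w.
Proof.
move=> ab bc yab ybc [ua ub uc] [va vb vc] uvd /bruhatP uw /bruhatP vw.
apply/bruhatP => p m; have := uw p m; have := vw p m.
have ca : c != a by rewrite -val_eqE /=; lia.
have ba : b != a by rewrite -val_eqE /=; lia.
have cb : c != b by rewrite -val_eqE /=; lia.
have E (z : 'S_n) : cnt z p m = ((a < p) && (z a < m)) + ((b < p) && (z b < m)) +
     ((c < p) && (z c < m)) +
     \sum_(d | [&& d != a, d != b & d != c]) ((d < p) && (z d < m)).
  rewrite /cnt (bigD1 a) //= (bigD1 b) //= (bigD1 c) /= ?ca ?cb // !addnA.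
  by congr (_ + _); apply: eq_bigl => d; rewrite andbA.
rewrite (E u) (E v) (E (tperm a c * y)%g) !permM tpermL tpermR tpermD ?(eq_sym a) //.
rewrite ua ub uc va vb vc.
set R := (X in _ <= _ + X -> _ -> _).
have -> : \sum_(d | [&& d != a, d != b & d != c]) ((d < p) && (u d < m)) = R.
  by apply: eq_bigr => d /and3P[da db dc]; have [-> ->] := uvd d da db dc.
have -> : \sum_(d | [&& d != a, d != b & d != c])
            ((d < p) && ((tperm a c * y)%g d < m)) = R.
  apply: eq_bigr => d /and3P[da db dc]; have [_ ->] := uvd d da db dc.
  by rewrite permM tpermD // eq_sym.
move: R (cnt w p m) => R C.
move: (nat_of_ord a) (nat_of_ord b) (nat_of_ord c) ab bc => a' b' c' ab bc.
move: (nat_of_ord (y a)) (nat_of_ord (y b)) (nat_of_ord (y c)) yab ybc => ya yb yc yab ybc.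
lia.
Qed.

Definition nedges n (w x : 'S_n) : nat :=
  pair_sum (fun a b => bruhat (tperm a b * x)%g w).

(* For each third letter l the four transpositions (i l), (j l) at x and at
   [tperm i j * x] are compared inside an S_3 coset; 312 and 231 below w imply
   321 below w, which is special to type A. *)
Lemma nedges_swap n (w x : 'S_n) (i j : 'I_n) : i < j -> x i < x j ->
  bruhat (tperm i j * x)%g w -> nedges w (tperm i j * x)%g <= nedges w x.
Proof.
move=> ij xij; have [x1 Ex1] : exists x1, x1 = (tperm i j * x)%g by eexists.
rewrite -Ex1 => x1w.
have xw : bruhat x w by apply: bruhat_trans x1w; rewrite Ex1; exact: bruhat_swap.
have ne : i != j by rewrite neq_ltn ij.
have x1i : x1 i = x j by rewrite Ex1 permM tpermL.
have x1j : x1 j = x i by rewrite Ex1 permM tpermR.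
have x1D l : l != i -> l != j -> x1 l = x l.
  by move=> li lj; rewrite Ex1 permM tpermD // eq_sym.
apply: (@pair_sum_swap_le _ _ _ i j) => //.
- by move=> a b; rewrite tpermC.
- by move=> a b; rewrite tpermC.
- by rewrite -Ex1 x1w; case: bruhat.
- move=> l li lj.
  have il : i != l by rewrite eq_sym.
  have jl : j != l by rewrite eq_sym.
  have ji : j != i by rewrite eq_sym.
  (* [U] and [V] are the neighbours of [x1], [A] and [B] those of [x]. Of [A] and [B], at least as
     many must lie below [w] as of [U] and [V]. *)
  have [U EU] : exists U, U = (tperm i l * x1)%g by eexists.
  have [V EV] : exists V, V = (tperm j l * x1)%g by eexists.
  have [A EA] : exists A, A = (tperm i l * x)%g by eexists.
  have [B EB] : exists B, B = (tperm j l * x)%g by eexists.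
  rewrite -EU -EV -EA -EB.
  have [Ui Uj Ul] : [/\ U i = x l, U j = x i & U l = x j].
    by rewrite EU !permM tpermL tpermR (tpermD ne lj) x1j x1i x1D.
  have [Vi Vj Vl] : [/\ V i = x j, V j = x l & V l = x i].
    by rewrite EV !permM tpermL tpermR (tpermD ji li) x1j x1i x1D.
  have [Ai Aj Al] : [/\ A i = x l, A j = x j & A l = x i].
    by rewrite EA !permM tpermL tpermR (tpermD ne lj).
  have [Bi Bj Bl] : [/\ B i = x i, B j = x l & B l = x j].
    by rewrite EB !permM tpermL tpermR (tpermD ji li).
  have D d : d != i -> d != j -> d != l ->
      [/\ A d = x d, B d = x d, U d = x d & V d = x d].
    move=> di dj dl; rewrite EA EB EU EV !permM !tpermD 1?eq_sym //.
    by rewrite x1D.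
  have EBU : (tperm i j * B = U)%g.
    apply/permP => d; rewrite permM; case: tpermP => [->|->|/eqP di /eqP dj].
    - by rewrite Bj Ui.
    - by rewrite Bi Uj.
    - by have [->|dl] := eqVneq d l; [rewrite Bl Ul | have [_ -> -> _] := D d di dj dl].
  have EAV : (tperm i j * A = V)%g.
    apply/permP => d; rewrite permM; case: tpermP => [->|->|/eqP di /eqP dj].
    - by rewrite Aj Vi.
    - by rewrite Ai Vj.
    - by have [->|dl] := eqVneq d l; [rewrite Al Vl | have [-> _ _ ->] := D d di dj dl].
  have EBV : (tperm i l * B = V)%g.
    apply/permP => d; rewrite permM; case: tpermP => [->|->|/eqP di /eqP dl].
    - by rewrite Bl Vi.
    - by rewrite Bi Vl.
    - by have [->|dj] := eqVneq d j; [rewrite Bj Vj | have [_ -> _ ->] := D d di dj dl].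
  have EUA : (tperm j l * A = U)%g.
    apply/permP => d; rewrite permM; case: tpermP => [->|->|/eqP dj /eqP dl].
    - by rewrite Al Uj.
    - by rewrite Aj Ul.
    - by have [->|di] := eqVneq d i; [rewrite Ai Ui | have [-> _ -> _] := D d di dj dl].
  have BU : x i < x l -> bruhat U w -> bruhat B w.
    by move=> H; apply: bruhat_trans; rewrite -EBU bruhat_swap // Bi Bj.
  have AV : x l < x j -> bruhat V w -> bruhat A w.
    by move=> H; apply: bruhat_trans; rewrite -EAV bruhat_swap // Ai Aj.
  have BV : i < l -> bruhat V w -> bruhat B w.
    by move=> H; apply: bruhat_trans; rewrite -EBV bruhat_swap // Bi Bl.
  have AU : l < j -> bruhat U w -> bruhat A w.
    by move=> H; apply: bruhat_trans; rewrite -EUA tpermC bruhat_swap // Al Aj.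
  have Bx : j < l -> x l < x j -> bruhat B w.
    by move=> H H'; apply: bruhat_trans xw; rewrite EB bruhat_unswap.
  have Ax : l < i -> x i < x l -> bruhat A w.
    by move=> H H'; apply: bruhat_trans xw; rewrite EA tpermC bruhat_unswap.
  (* When [l] lies beyond [j] in position and in value, [U] and [V] are the patterns 312 and 231 and
     [A] is 321; [joinB] is the mirror case. *)
  have joinA : j < l -> x j < x l -> bruhat U w -> bruhat V w -> bruhat A w.
    move=> H H'; rewrite EA; apply: (@bruhat_join _ x U V w i j l) => //.
    by move=> d di dj dl; have [_ _ -> ->] := D d di dj dl.
  have joinB : l < i -> x l < x i -> bruhat U w -> bruhat V w -> bruhat B w.
    move=> H H'; rewrite EB tpermC; apply: (@bruhat_join _ x U V w l i j) => //.
    by move=> d dl di dj; have [_ _ -> ->] := D d di dj dl.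
  have xli : x l != x i by rewrite (inj_eq perm_inj).
  have xlj : x l != x j by rewrite (inj_eq perm_inj).
  move: li lj xli xlj BU AV BV AU Bx Ax joinA joinB; rewrite -!val_eqE /=.
  move: ij xij; clear; lia.
(* Disjoint transpositions commute, so [tperm a b * x] lies below [tperm a b * x1]. *)
- move=> a b ai aj bi bj ab; case Hb: (bruhat (tperm a b * x1)%g w) => //.
  suff -> : bruhat (tperm a b * x)%g w by [].
  apply: bruhat_trans Hb.
  have -> : (tperm a b * x1 = tperm i j * (tperm a b * x))%g.
    rewrite Ex1 !mulgA; congr (_ * _)%g; rewrite [RHS]conjgC tpermJ.
    by rewrite !tpermD // eq_sym.
  by apply: bruhat_swap; rewrite // !permM !tpermD.
Qed.

Lemma bruhat_tperm n (x : 'S_n) (a b : 'I_n) : a < b ->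
  bruhat (tperm a b * x)%g x = (x b < x a).
Proof.
move=> ab; have [xba|xab] := ltnP (x b) (x a); first exact: bruhat_unswap.
apply/bruhatP => H; have xab' : x a < x b.
  rewrite ltn_neqAle xab andbT val_eqE (inj_eq perm_inj) -val_eqE /=.
  by rewrite neq_ltn ab.
have := congr1 (fun s : 'S_n => s a) (dle_anti H (dle_swap ab xab')).
by rewrite permM tpermL => E; move: xab'; rewrite E ltnn.
Qed.

(** Deodhar's inequality: at [x = w] the count is the number of inversions, and [nedges_swap] shows
    that it does not drop on the way down. *)
Lemma nedges_ge n (w x : 'S_n) : bruhat x w -> ninv w <= nedges w x.
Proof.
move/bruhatP; move: x; apply: dle_ind => [|x i j ij xij _ xw IH].
  by apply: leq_pair_sum => a b ab; rewrite bruhat_tperm.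
by apply: leq_trans IH _; apply: nedges_swap => //; apply/bruhatP.
Qed.

(* Double counting: the edges going down from x are its inversions. *)
Lemma sum_nedges n (w : 'S_n) :
  \sum_(x | bruhat x w) nedges w x = \sum_(x | bruhat x w) (ninv x).*2.
Proof.
transitivity (\sum_(a < n) \sum_(b < n) (a < b) *
   \sum_(x | bruhat x w) (bruhat (tperm a b * x)%g w : nat)).
  rewrite /nedges /pair_sum exchange_big /=; apply: eq_bigr => a _.
  by rewrite exchange_big /=; apply: eq_bigr => b _; rewrite big_distrr.
transitivity (\sum_(a < n) \sum_(b < n) (a < b) *
   \sum_(x | bruhat x w) (x b < x a).*2); last first.
  rewrite (eq_bigr (fun x : 'S_n => \sum_(a < n) \sum_(b < n) (a < b) * (x b < x a).*2)).
    rewrite [RHS]exchange_big; apply: eq_bigr => a _ /=.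
    by rewrite [RHS]exchange_big; apply: eq_bigr => b _ /=; rewrite big_distrr.
  move=> x _; rewrite /ninv /pair_sum -mul2n big_distrr; apply: eq_bigr => a _ /=.
  by rewrite big_distrr; apply: eq_bigr => b _ /=; rewrite -mul2n mulnCA.
apply: eq_bigr => a _; apply: eq_bigr => b _; case: ltnP => // ab; rewrite !mul1n.
rewrite (eq_bigr (fun x : 'S_n => (bruhat (tperm a b * x)%g w && (x b < x a)) +
    (bruhat (tperm a b * x)%g w && (x a < x b)))); last first.
  move=> x _; have : x a != x b by rewrite (inj_eq perm_inj) neq_ltn ab.
  by rewrite -val_eqE /=; lia.
(* The substitution of [tperm a b * x] for [x] turns the edges going up at [(a, b)] into those going
   down, whence the factor two. *)
rewrite big_split /= [X in _ + X]big_mkcond /= [X in _ + X](reindex_inj (mulgI (tperm a b))) /=.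
rewrite -[X in _ + X]big_mkcond /= [X in _ + X]big_mkcond [X in X + _]big_mkcond.
rewrite -big_split [RHS]big_mkcond /=; apply: eq_bigr => x _.
rewrite mulgA tperm2 mul1g !permM tpermL tpermR.
case xw: (bruhat x w); last by case: ifP.
have [xba|xab] := ltnP (x b) (x a); last by rewrite !andbF; case: ifP.
by rewrite (bruhat_trans (bruhat_unswap ab xba) xw).
Qed.

(** No [nedges w x] is smaller than [ninv w] and the totals agree, so no summand can be larger. *)
Lemma nedges1_eq n (w : 'S_n) :
  \sum_(x | bruhat x w) (ninv x).*2 = \sum_(x | bruhat x w) ninv w ->
  nedges w 1%g = ninv w.
Proof.
rewrite -sum_nedges => E; have w1 : bruhat 1%g w by apply/bruhatP; exact: dle_1.
apply/eqP; rewrite eqn_leq nedges_ge // andbT.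
move: E; rewrite (bigD1 1%g) //= [RHS](bigD1 1%g) //= => E.
have H : \sum_(x | bruhat x w && (x != 1%g)) ninv w <=
    \sum_(x | bruhat x w && (x != 1%g)) nedges w x.
  by apply: leq_sum => x /andP[xw _]; apply: nedges_ge.
by rewrite -(leq_add2r (\sum_(x | bruhat x w && (x != 1%g)) ninv w)) -E leq_add2l.
Qed.

(** * Minimal coset representatives and palindromicity *)

(** With [j = k.+1] the generators exchange neighbouring ordinals from [k] on, hence lie in the
    pointwise stabiliser of the first [k]. *)
Lemma simple_from_fix n k (z : 'S_n) (i : 'I_n) :
  z \in <<simple_from n k.+1>>%g -> i < k -> z i = i.
Proof.
move=> zJ ik; suff /subsetP/(_ _ zJ) /astabP/(_ i) :
    <<simple_from n k.+1>>%g \subset 'C([set i : 'I_n | i < k] | 'P)%g.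
  by rewrite inE ik => /(_ isT).
rewrite gen_subG; apply/subsetP => t /simple_fromP[a [b [ba kb ->]]].
apply/astabP => c; rewrite inE => ck /=; rewrite /aperm tpermD // -val_eqE /=; lia.
Qed.

Lemma cnt_fix n k (z x : 'S_n) p m : (forall i : 'I_n, i < k -> z i = i) ->
  p <= k -> cnt (z * x)%g p m = cnt x p m.
Proof.
move=> zfix pk; apply: eq_bigr => i _; rewrite permM.
by have [ip|//] := ltnP i p; rewrite zfix // (leq_trans ip).
Qed.

(** A descent of [w^-1] beyond [k] would give a shorter element of the coset. Conversely, the
    inverses of all elements of the coset share their counts up to [k], so the one with increasing
    tail is the lowest. *)
Lemma min_repsP n k (w : 'S_n) :
  reflect (tail_inc k w^-1%g) (w \in min_reps (simple_from n k.+1)).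
Proof.
rewrite inE; apply: (iffP forall_inP) => [H|winc u uJ].
  apply: tail_inc_step => a b ka ba; have [//|] := ltnP.
  rewrite leq_eqVlt => /orP[/eqP/val_inj/perm_inj E|lt_ba].
    by move: ba; rewrite E; lia.
  have tJ : tperm a b \in <<simple_from n k.+1>>%g.
    by apply: mem_gen; apply/simple_fromP; exists a, b; split=> //; lia.
  have := H _ tJ; rewrite !len_inv -(invV w) (inv_desc ba lt_ba) -invV.
  by rewrite invMg invgK tpermV ltnn.
rewrite !len_inv -(invV w) -(invV (w * u)%g); apply: dle_inv.
apply: (tail_inc_dle winc) => p m pk; rewrite invMg (@cnt_fix _ k) // => i ik.
by apply: (simple_from_fix _ ik); rewrite groupV.
Qed.

Lemma coset_min_rep n k (x : 'S_n) : let J := simple_from n k.+1 in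
  \sum_(z in <<J>>%g) ((z * x)^-1%g \in min_reps J) = 1.
Proof.
move=> J; case: (arg_minnP (P := fun z : 'S_n => z \in <<J>>%g)
  (fun z : 'S_n => ninv (z * x)%g) (group1 <<J>>%G)) => z0 z0J min_z0.
have z0x : (z0 * x)^-1%g \in min_reps J.
  rewrite inE; apply/forall_inP => u uJ; rewrite !len_inv -invV invgK.
  rewrite -[X in _ <= X]invV invMg invgK mulgA; apply: min_z0.
  by rewrite groupM // groupV.
rewrite (bigD1 z0) //= z0x big1 // => z /andP[zJ zz0].
apply/eqP; rewrite eqb0; apply: contra zz0 => /min_repsP zx.
move/min_repsP: z0x => z0x; rewrite !invgK in zx z0x.
have E (u v : 'S_n) : u \in <<J>>%g -> v \in <<J>>%g -> tail_inc k (u * x)%g ->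
    dle (u * x)%g (v * x)%g.
  move=> uJ vJ ux; apply: (tail_inc_dle ux) => p m pk.
  by rewrite !(@cnt_fix _ k) // => i; apply: simple_from_fix.
by apply/eqP/(mulIg x)/dle_anti; apply: E.
Qed.

(** For data constant on cosets: insert the sum of [coset_min_rep], which is 1, exchange the sums
    and reindex by [z * x]. *)
Lemma sum_cosets n k (K : pred 'S_n) (F : 'S_n -> nat) :
  let J := simple_from n k.+1 in
  (forall z x, z \in <<J>>%g -> K (z * x)%g = K x /\ F (z * x)%g = F x) ->
  \sum_(x | K x) F x =
  #|<<J>>%g| * \sum_(x | K x && (x^-1%g \in min_reps J)) F x.
Proof.
move=> J KF.
transitivity (\sum_(x | K x) \sum_(z in <<J>>%g) ((z * x)^-1%g \in min_reps J) * F x).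
  by apply: eq_bigr => x _; rewrite -big_distrl /= coset_min_rep mul1n.
rewrite exchange_big /= -sum_nat_const; apply: eq_bigr => z zJ.
rewrite [RHS]big_mkcond [RHS](reindex_inj (mulgI z)) /= [LHS]big_mkcond /=.
apply: eq_bigr => x _; have [-> ->] := KF _ x zJ.
by case: (K x) => //=; case: (_ \in _); rewrite ?mul1n.
Qed.

(** * Inversions split at a position, and the longest coset element *)

Definition head_inv n k (x : 'S_n) : nat := pair_sum (fun a b => (a < k) && (x b < x a)).
Definition tail_inv n k (x : 'S_n) : nat := pair_sum (fun a b => (k <= a) && (x b < x a)).

Lemma inv_head_tail n k (x : 'S_n) : ninv x = head_inv k x + tail_inv k x.
Proof.
rewrite /ninv /head_inv /tail_inv /pair_sum -big_split; apply: eq_bigr => a _ /=.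
by rewrite -big_split; apply: eq_bigr => b _ /=; case: (leqP k a); lia.
Qed.

(** Of the [x a] values below [x a], those not to the left of [a] are to its right. This form
    involves only positions before [k], which makes it constant on cosets. *)
Lemma head_invE n k (x : 'S_n) :
  head_inv k x = \sum_(a < n) (a < k) * (x a - cnt x a (x a)).
Proof.
apply: eq_bigr => a _; have [ak|ak] := ltnP a k; last by rewrite big1 // => b; rewrite muln0.
rewrite mul1n; suff : \sum_(b < n) (a < b) * (true && (x b < x a)) + cnt x a (x a) = x a by lia.
transitivity (\sum_(b < n) (x b < x a)); last first.
  by rewrite sum_perm_lt; apply/minn_idPl/ltnW.
rewrite /cnt -big_split; apply: eq_bigr => b _ /=.
by case: (ltngtP a b) => [ab|ba|/val_inj ->] /=; rewrite ?ltnn ?addn0 ?mul1n ?mul0n.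
Qed.

Lemma head_inv_fix n k (z x : 'S_n) : (forall i : 'I_n, i < k -> z i = i) ->
  head_inv k (z * x)%g = head_inv k x.
Proof.
move=> zfix; rewrite !head_invE; apply: eq_bigr => a _.
have [ak|//] := ltnP a k; rewrite (cnt_fix _ _ zfix (ltnW ak)) permM zfix //.
Qed.

Lemma tail_inv_inc n k (x : 'S_n) : tail_inc k x -> tail_inv k x = 0.
Proof.
move=> xinc; rewrite /tail_inv /pair_sum big1 // => a _; rewrite big1 // => b _.
by have [ab|//] := ltnP a b; have [ka|//] := leqP k a; have := xinc _ _ ka ab; lia.
Qed.

(** Reversal of the positions [k] to [n.-1], the longest element of W_J. The default of [insubd] is
    never reached. *)
Definition tail_rev_fun n k (i : 'I_n) : 'I_n :=
  if k <= i then insubd i (n.-1 + k - i) else i.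

Lemma val_tail_rev_fun n k (i : 'I_n) :
  tail_rev_fun k i = (if k <= i then n.-1 + k - i else i) :> nat.
Proof.
rewrite /tail_rev_fun; case: leqP => // ki; rewrite val_insubd.
by rewrite ifT //; have := ltn_ord i; lia.
Qed.

Lemma tail_rev_funK n k : involutive (@tail_rev_fun n k).
Proof.
move=> i; apply: val_inj; rewrite /= !val_tail_rev_fun; have ilt := ltn_ord i.
by have [ki|ki] := leqP k i; [rewrite ifT; lia | rewrite ifF; lia].
Qed.

Definition tail_rev n k : 'S_n := perm (can_inj (@tail_rev_funK n k)).

Lemma tail_revE n k (i : 'I_n) :
  tail_rev n k i = (if k <= i then n.-1 + k - i else i) :> nat.
Proof. by rewrite permE val_tail_rev_fun. Qed.

Lemma tail_rev_fix n k (i : 'I_n) : i < k -> tail_rev n k i = i.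
Proof. by move=> ik; apply: val_inj; rewrite /= tail_revE leqNgt ik. Qed.

Lemma tail_revK n k (i : 'I_n) : tail_rev n k (tail_rev n k i) = i.
Proof. by rewrite !permE tail_rev_funK. Qed.

Lemma tail_inv_rev n k (x : 'S_n) :
  tail_inv k x + tail_inv k (tail_rev n k * x)%g = @pair_sum n (fun a _ => k <= a).
Proof.
have -> : tail_inv k (tail_rev n k * x)%g = pair_sum (fun a b => (k <= a) && (x a < x b)).
  rewrite /tail_inv /pair_sum (reindex_inj (@perm_inj _ (tail_rev n k))) exchange_big.
  rewrite (reindex_inj (@perm_inj _ (tail_rev n k))) /=.
  apply: eq_bigr => a _; apply: eq_bigr => b _; rewrite !permM !tail_revK !tail_revE.
  by have := ltn_ord a; have := ltn_ord b; have [ka|ka] := leqP k a;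
     have [kb|kb] := leqP k b => /=; lia.
rewrite /tail_inv /pair_sum -big_split; apply: eq_bigr => a _ /=.
rewrite -big_split; apply: eq_bigr => b _ /=.
have [ab|//] := ltnP a b; have : x a != x b by rewrite (inj_eq perm_inj) neq_ltn ab.
by rewrite -val_eqE /=; lia.
Qed.

Lemma bruhatV n (u v : 'S_n) : bruhat u^-1%g v^-1%g = bruhat u v.
Proof. by apply/bruhatP/bruhatP => /dleV. Qed.

Lemma tail_rev_dec n k (x : 'S_n) : tail_inc k x -> tail_dec k (tail_rev n k * x)%g.
Proof.
move=> xinc a b ka ab; rewrite !permM; have := ltn_ord b.
have kb := leq_trans ka (ltnW ab).
by move=> bn; apply: xinc; rewrite !tail_revE kb ?ka; lia.
Qed.

(** Both comparisons are decided by the counts up to [k], which the reversal does not affect. *)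
Lemma bruhat_tail_rev n k (x y : 'S_n) : tail_inc k x -> tail_inc k y ->
  bruhat x (tail_rev n k * y)%g = bruhat x y.
Proof.
move=> xinc yinc; have fix_rev := @tail_rev_fix n k.
apply/bruhatP/bruhatP => xy.
  apply: (tail_inc_dle xinc) => p m pk.
  by rewrite -(cnt_fix _ _ fix_rev pk); apply: xy.
apply: (tail_dec_dle (tail_rev_dec yinc)) => p m pk.
by rewrite (cnt_fix _ _ fix_rev pk); apply: xy.
Qed.

(** By symmetry [rk] and [d - rk] have the same distribution, hence the same sum. *)
Lemma palindromic_sum (T : finType) (P : {set T}) (rk : T -> nat) d :
  (forall v, v \in P -> rk v <= d) ->
  (forall i, i <= d -> \sum_(v in P) (rk v == d - i) = \sum_(v in P) (rk v == i)) ->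
  \sum_(v in P) (rk v).*2 = \sum_(v in P) d.
Proof.
move=> le_d sym.
have E (f : nat -> nat) :
    \sum_(v in P) f (rk v) = \sum_(i < d.+1) f i * \sum_(v in P) (rk v == i).
  under [RHS]eq_bigr do rewrite big_distrr.
  rewrite exchange_big; apply: eq_bigr => v vP /=; have lt_d := le_d v vP.
  rewrite -ltnS in lt_d; rewrite (bigD1 (Ordinal lt_d)) //= eqxx muln1 big1 ?addn0 //.
  by move=> i ne; rewrite eq_sym (negbTE (ne : (i : nat) != rk v)) muln0.
have {}E : \sum_(v in P) rk v = \sum_(v in P) (d - rk v).
  rewrite (E id) (E (subn d)) [RHS](reindex_inj rev_ord_inj) /=.
  apply: eq_bigr => i _; rewrite subSS sym -1?ltnS // subKn // -ltnS //.
rewrite (eq_bigr (fun v => rk v + rk v)); last by move=> v _; rewrite addnn.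
rewrite big_split /= {1}E -big_split; apply: eq_bigr => v vP /=.
by rewrite subnK // le_d.
Qed.

Lemma smooth_sum n (J : {set 'S_n}) (w : 'S_n) : rationally_smooth J w ->
  \sum_(v in lower_interval J w) (ninv v).*2 =
  \sum_(v in lower_interval J w) ninv w.
Proof.
move=> smooth; apply: palindromic_sum => [v|i].
  by rewrite inE => /andP[_]; exact: bruhat_inv.
have coefE m : ((poincare J w)`_m = (\sum_(v in lower_interval J w) (ninv v == m))%:R)%R.
  rewrite coef_sum natr_sum; apply: eq_bigr => v _.
  by rewrite coefXn len_inv eq_sym.
move=> le_i; have := congr1 (fun p : {poly int} => p`_i)%R smooth.
rewrite /rev_poly coef_poly !len_inv ltnS le_i !coefE.
by move/eqP; rewrite Num.Theory.eqr_nat => /eqP.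
Qed.

(** The interval below the longest coset element [om] is a union of full cosets. There head
    inversions average as in the parabolic interval, and tail inversions average to half their
    maximum, so lengths average to half that of [om]. *)
Lemma smooth_nedges n k (w : 'S_n) : let J := simple_from n k.+1 in
  w \in min_reps J -> rationally_smooth J w ->
  let om := (tail_rev n k * w^-1)%g in nedges om 1%g = ninv om.
Proof.
move=> J wJ smooth om; have winc := elimT (min_repsP k w) wJ.
set C := @pair_sum n (fun a _ => k <= a).
have fix_rev := @tail_rev_fix n k.
have omK (z x : 'S_n) : (forall i : 'I_n, i < k -> z i = i) ->
    bruhat (z * x)%g om = bruhat x om.
  move=> zfix; have H (u v : 'S_n) : (forall p m, p <= k -> cnt u p m = cnt v p m) ->
      bruhat u om -> bruhat v om.
    move=> uv /bruhatP uo; apply/bruhatP; apply: (tail_dec_dle (tail_rev_dec winc)).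
    by move=> p m pk; rewrite -uv //; apply: uo.
  by apply/idP/idP; apply: H => p m pk; rewrite (cnt_fix _ _ zfix pk).
have memLI (x : 'S_n) : (x^-1%g \in lower_interval J w) =
    bruhat x om && (x^-1%g \in min_reps J).
  rewrite in_set andbC; case xJ: (_ \in _); rewrite ?andbF //= andbT.
  have /min_repsP := xJ; rewrite invgK => xinc.
  rewrite -[bruhat x^-1%g w]bruhatV invgK andbT; exact: esym (bruhat_tail_rev xinc winc).
have inv_om : ninv om = ninv w + C.
  rewrite -[ninv w]invV (inv_head_tail k) (head_inv_fix _ fix_rev).
  by rewrite [ninv w^-1](inv_head_tail k) /C -(tail_inv_rev k w^-1) (tail_inv_inc winc) addn0.
have sum_head : \sum_(x | bruhat x om) (head_inv k x).*2 = \sum_(x | bruhat x om) ninv w.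
  have JK (z x : 'S_n) : z \in <<J>>%g -> bruhat (z * x)%g om = bruhat x om.
    by move=> zJ; apply: omK => i; apply: simple_from_fix.
  rewrite (@sum_cosets n k _ (fun x => (head_inv k x).*2)); last first.
    move=> z x zJ; split; first exact: JK.
    by rewrite head_inv_fix // => i; apply: simple_from_fix.
  rewrite (@sum_cosets n k _ (fun=> ninv w)) => [|z x zJ]; last by rewrite JK.
  congr (_ * _).
  transitivity (\sum_(v in lower_interval J w) (ninv v).*2).
    rewrite [RHS](reindex_inj (@invg_inj _)) /=; apply: eq_big => x; first by rewrite memLI.
    case/andP=> _ /min_repsP; rewrite invgK => xinc.
    by rewrite invV (inv_head_tail k) tail_inv_inc // addn0.
  rewrite smooth_sum // [LHS](reindex_inj (@invg_inj _)) /=.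
  by apply: eq_bigl => x; rewrite memLI.
apply: nedges1_eq.
(* Each [x] is paired with [tail_rev n k * x]: the head inversions agree and the tail inversions add
   up to [C]. *)
transitivity (\sum_(x | bruhat x om) (ninv x + ninv (tail_rev n k * x)%g)).
  rewrite big_split /= (eq_bigr (fun x => ninv x + ninv x)) => [|x _]; last by rewrite addnn.
  rewrite big_split /=; congr (_ + _).
  rewrite [LHS](reindex_inj (mulgI (tail_rev n k))) /=; apply: eq_bigl => x.
  exact: omK.
transitivity (\sum_(x | bruhat x om) ((head_inv k x).*2 + C)).
  apply: eq_bigr => x _; rewrite !(inv_head_tail k) (head_inv_fix _ fix_rev).
  by rewrite /C -(tail_inv_rev k x); lia.
by rewrite big_split /= sum_head -big_split /=; apply: eq_bigr => x _; rewrite inv_om.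
Qed.

(** * Equality at the identity *)

(* For i < j this says that the transposition (i j) lies below w. *)
Definition spanned n (w : 'S_n) (i j : 'I_n) : bool :=
  [exists a : 'I_n, (a <= i) && (j <= w a)] &&
  [exists b : 'I_n, (j <= b) && (w b <= i)].

Lemma spannedP n (w : 'S_n) (i j : 'I_n) :
  reflect ((exists2 a : 'I_n, a <= i & j <= w a) /\ (exists2 b : 'I_n, j <= b & w b <= i))
          (spanned w i j).
Proof.
by apply: (iffP andP) => [[/exists_inP H /exists_inP H']|[/exists_inP H /exists_inP H']].
Qed.

Definition nspanned n (w : 'S_n) : nat := pair_sum (spanned w).

Lemma spannedV n (w : 'S_n) i j : spanned w^-1%g i j = spanned w i j.
Proof.
by apply/spannedP/spannedP => -[[a ai ja] [b jb bi]]; split;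
  [exists ((w^-1)%g b)|exists ((w^-1)%g a)|exists (w b)|exists (w a)];
  rewrite ?permK ?permKV.
Qed.

Lemma nspannedV n (w : 'S_n) : nspanned w^-1%g = nspanned w.
Proof. by apply: eq_pair_sum => a b _; rewrite spannedV. Qed.

(** On the rectangle where [tperm i j] falls one short of the identity count [minn p m], so does
    [w]: the position [a] is before [p] with a value at least [m], and [b] is from [p] on with a
    value below [m]. *)
Lemma spanned_bruhat n (w : 'S_n) (i j : 'I_n) : i < j -> spanned w i j ->
  bruhat (tperm i j) w.
Proof.
move=> ij /spannedP[[a ai ja] [b jb bi]]; apply/bruhatP => p m.
have := @cnt_swap n 1%g i j p m ij; rewrite !perm1 mulg1 => /(_ ij).
case: andP => [[/andP[ip pj] /andP[im mj]]|_]; last by rewrite addn0 => ->; exact: dle_1.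
suff lt1 : cnt w p m < cnt (1%g : 'S_n) p m.
  by move=> E; have := leq_trans lt1 (eq_leq (esym E)); rewrite addn1 ltnS.
have -> : cnt (1%g : 'S_n) p m = minn p m.
  transitivity (\sum_(l < n) (l < minn p m)).
    by apply: eq_bigr => l _; rewrite perm1 leq_min.
  by rewrite sum_ord_lt; apply/minn_idPl; have := ltn_ord j; lia.
have sum1 c : \sum_(l < n) (l == c) = 1.
  by rewrite (bigD1 c) //= eqxx big1 // => l /negbTE ->.
rewrite leq_min -!(addn1 (cnt w p m)); apply/andP; split.
  rewrite -[leqRHS](_ : \sum_(l < n) (l < p) = p); last first.
    by rewrite sum_ord_lt; apply/minn_idPl; have := ltn_ord j; lia.
  rewrite -(sum1 a) /cnt -big_split; apply: leq_sum => l _ /=.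
  by have [->|_] := eqVneq l a; lia.
rewrite -[leqRHS](_ : \sum_(l < n) (w l < m) = m); last first.
  by rewrite sum_perm_lt; apply/minn_idPl; have := ltn_ord j; lia.
rewrite -(sum1 b) /cnt -big_split; apply: leq_sum => l _ /=.
by have [->|_] := eqVneq l b; lia.
Qed.

Lemma nspanned_le n (w : 'S_n) : nspanned w <= nedges w 1%g.
Proof.
apply: leq_pair_sum => i j ij; rewrite mulg1.
by case: (boolP (spanned w i j)) => // /(spanned_bruhat ij) ->.
Qed.

Lemma lift_permP n (w : 'S_n.+1) i : exists y, w = lift_perm i (w i) y.
Proof.
have H (k : 'I_n) : exists h : 'I_n, w (lift i k) == lift (w i) h.
  have : w i != w (lift i k) by rewrite (inj_eq perm_inj) neq_lift.
  by case/unlift_some => h -> _; exists h.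
pose f k := xchoose (H k).
have fE k : w (lift i k) = lift (w i) (f k) by exact: (eqP (xchooseP (H k))).
have f_inj : injective f.
  move=> a b E; apply: (@lift_inj _ i); apply: (@perm_inj _ w).
  by rewrite !fE E.
exists (perm f_inj); apply/permP => a; case: (unliftP i a) => [b|] ->.
  by rewrite lift_perm_lift permE.
by rewrite lift_perm_id.
Qed.

Lemma val_lift n (q : 'I_n.+1) (i : 'I_n) : lift q i = (q <= i) + i :> nat.
Proof. by []. Qed.

Lemma pair_sum_recl n (F : 'I_n.+1 -> 'I_n.+1 -> nat) :
  pair_sum F = \sum_(b < n) F ord0 (lift ord0 b) +
               pair_sum (fun a b : 'I_n => F (lift ord0 a) (lift ord0 b)).
Proof.
rewrite /pair_sum big_ord_recl big_ord_recl ltnn mul0n add0n; congr (_ + _).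
  by apply: eq_bigr => b _; rewrite mul1n.
by apply: eq_bigr => a _; rewrite big_ord_recl mul0n add0n.
Qed.

Lemma sum_ord_lt_ord n (q : 'I_n.+1) : \sum_(b < n) (b < q) = q.
Proof. by rewrite sum_ord_lt; apply/minn_idPl; rewrite -ltnS. Qed.

Lemma ninv_lift n (q : 'I_n.+1) (y : 'S_n) : ninv (lift_perm ord0 q y) = q + ninv y.
Proof.
rewrite /ninv pair_sum_recl lift_perm_id; congr (_ + _).
  rewrite -[RHS]sum_ord_lt_ord [RHS](reindex_inj (@perm_inj _ y)) /=.
  by apply: eq_bigr => b _; rewrite lift_perm_lift ?lift0 ?val_lift; lia.
by apply: eq_pair_sum => a b _; rewrite !lift_perm_lift ?lift0 ?val_lift; lia.
Qed.

Lemma spanned_lift n (q : 'I_n.+1) (y : 'S_n) (i j : 'I_n) : i < j -> spanned y i j ->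
  spanned (lift_perm ord0 q y) (lift ord0 i) (lift ord0 j).
Proof.
move=> ij /spannedP[[a ai ja] [b jb bi]]; apply/spannedP; split; last first.
  by exists (lift ord0 b) => //; rewrite lift_perm_lift ?lift0 ?val_lift; lia.
have [qa|aq] := leqP q (y a).
  by exists (lift ord0 a) => //; rewrite lift_perm_lift ?lift0 ?val_lift; lia.
(* Here [y a < q], so its value is not shifted; the first letter [q] is large enough instead. *)
by exists ord0; rewrite ?lift_perm_id ?lift0 //=; lia.
Qed.

Lemma nspanned_lift n (q : 'I_n.+1) (y : 'S_n) (w := lift_perm ord0 q y) :
  q <= (w^-1)%g ord0 ->
  nspanned w = \sum_(b < n) spanned w ord0 (lift ord0 b) +
     pair_sum (fun a b : 'I_n => spanned w (lift ord0 a) (lift ord0 b)) /\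
  q <= \sum_(b < n) spanned w ord0 (lift ord0 b).
Proof.
move=> qp; split; first exact: pair_sum_recl.
rewrite -[leqLHS]sum_ord_lt_ord; apply: leq_sum => b _.
case: ltnP => // bq; rewrite lt0b; apply/spannedP; split.
  by exists ord0; rewrite // lift_perm_id ?lift0 ?val_lift; lia.
by exists ((w^-1)%g ord0); rewrite ?permKV // ?lift0 ?val_lift; lia.
Qed.

(** Inversion of [w] allows the first letter [q] to be at most the position of 0. These two letters
    then span at least [q] pairs with first entry 0, and [q] is the number of inversions of the
    first letter. *)
Lemma nspanned_ge n (w : 'S_n) : ninv w <= nspanned w.
Proof.
elim: n w => [|n IH] w; first by rewrite /ninv /pair_sum big_ord0.
wlog qp : w / w ord0 <= (w^-1)%g ord0.
  move=> H; have [/H//|/ltnW pq] := leqP (w ord0) ((w^-1)%g ord0).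
  by rewrite -invV -nspannedV; apply: H; rewrite invgK.
have [y Ew] := lift_permP w ord0; rewrite Ew in qp *.
rewrite lift_perm_id in qp; have [-> Hq] := nspanned_lift qp.
rewrite ninv_lift leq_add // (leq_trans (IH y)) //.
by apply: leq_pair_sum => a b ab; case: (boolP (spanned y a b)) => // /spanned_lift ->.
Qed.

Lemma pair_sum_eq_leq n (F G : 'I_n -> 'I_n -> nat) :
  (forall a b : 'I_n, a < b -> G a b <= F a b) -> pair_sum F <= pair_sum G ->
  forall a b : 'I_n, a < b -> F a b = G a b.
Proof.
move=> GF le_FG a b ab; apply/eqP; rewrite eqn_leq GF // andbT.
have E : pair_sum F = pair_sum G + pair_sum (fun a b => F a b - G a b).
  rewrite /pair_sum -big_split; apply: eq_bigr => c _; rewrite -big_split.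
  apply: eq_bigr => d _ /=; case: ltnP => // cd.
  by rewrite !mul1n addnBCA ?subnn ?addn0 ?GF // leqnn.
have : pair_sum (fun a b => F a b - G a b) == 0 by lia.
rewrite sum_nat_eq0 => /forallP/(_ a); rewrite sum_nat_eq0 => /forallP/(_ b).
by rewrite ab mul1n subn_eq0.
Qed.

(* The values at most w(0) appear from left to right in decreasing order. *)
Definition initial_dec n (w : 'S_n.+1) : Prop :=
  forall l l' : 'I_n.+1, l < l' -> w l < w l' -> w ord0 < w l'.

(** Equality leaves no slack in either part of that count, so inserting the first letter creates no
    spanned pair among the shifted ones. *)
Lemma nspanned_tight n (q : 'I_n.+1) (y : 'S_n) (w := lift_perm ord0 q y) :
  nspanned w = ninv w -> q <= (w^-1)%g ord0 ->
  nspanned y = ninv y /\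
  forall i j : 'I_n, i < j -> spanned w (lift ord0 i) (lift ord0 j) -> spanned y i j.
Proof.
move=> tight qp; have [E le_q] := nspanned_lift qp.
have le_y := nspanned_ge y.
have le_s (a b : 'I_n) : a < b ->
    (spanned y a b : nat) <= spanned w (lift ord0 a) (lift ord0 b).
  by move=> ab; case: (boolP (spanned y a b)) => // /(@spanned_lift _ q) ->.
set S := pair_sum _ in E; have le_ys : nspanned y <= S by exact: leq_pair_sum le_s.
rewrite {}E ninv_lift in tight.
have Ey : nspanned y = ninv y by lia.
have le_S : S <= nspanned y by lia.
split=> // i j ij sij.
by have := pair_sum_eq_leq le_s le_S ij; rewrite sij; case: spanned.
Qed.

Lemma initial_dec_smooth n (w : 'S_n.+1) : nspanned w = ninv w ->
  w ord0 <= (w^-1)%g ord0 -> initial_dec w.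
Proof.
elim: n w => [|n IH] w tight.
  by move=> _ l l'; rewrite !ord1.
have [y Ew] := lift_permP w ord0; move: (w ord0) Ew => q Ew.
rewrite {w}Ew in tight *; set w := lift_perm _ _ _ => qp.
have [tight_y tight_s] := nspanned_tight tight qp.
have w0 : w ord0 = q by rewrite /w lift_perm_id.
have wS a : w (lift ord0 a) = lift q (y a) by rewrite /w lift_perm_lift.
have reduce : (forall a b : 'I_n.+1, a < b -> y a < y b -> q <= y b) -> initial_dec w.
  move=> H l l'; case: (unliftP ord0 l') => [b|] -> //.
  case: (unliftP ord0 l) => [a|] -> //; rewrite w0 !wS !lift0 !val_lift ltnS => ab yab.
  by have := H a b ab; lia.
have [q1|q1] := leqP q 1.
  by apply: reduce => a b _; lia.
have qn : q.-1 < n.+1 by have := ltn_ord q; lia.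
have pE : (w^-1)%g ord0 = lift ord0 ((y^-1)%g ord0).
  rewrite /w lift_permV (_ : ord0 = lift q ord0) ?lift_perm_lift //.
  by apply: val_inj; rewrite /= /bump; lia.
rewrite pE lift0 in qp.
(* The pair [(1, q)] is spanned in [w] by the first letter and the position of 0; in [y] it becomes
   [(0, q.-1)], for which only the first position can serve on the left. *)
have y0 : q.-1 <= y ord0.
  have /spannedP[[a]] : spanned y ord0 (Ordinal qn).
    apply: tight_s => /=; first by lia.
    apply/spannedP; split; first by exists ord0; rewrite ?w0 ?lift0 //=; lia.
    by exists ((w^-1)%g ord0); rewrite ?permKV // pE !lift0 /=; lia.
  by rewrite leqn0 => /eqP a0 /=; rewrite (_ : a = ord0) //; apply: val_inj.
have [yy|yy] := leqP (y ord0) ((y^-1)%g ord0).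
  by apply: reduce => a b ab yab; have := IH y tight_y yy a b ab yab; lia.
have decV : initial_dec y^-1%g.
  by apply: IH; rewrite ?nspannedV ?invV ?invgK // ltnW.
(* It remains to see that values below [q] occur no later than 0 does, where [decV] forbids ascents.
   A first violation [c] would make a pair spanned in [w], hence in [y], and so yield a smaller
   violation. *)
have early (c : 'I_n.+1) : c < q -> (y^-1)%g c <= (y^-1)%g ord0.
  have [m] := ubnP (nat_of_ord c); elim: m c => // m IHm c lt_m cq.
  have [//|lt_p] := leqP.
  have c0 : 0 < c.
    by rewrite lt0n; apply: contraTneq lt_p => c0; rewrite (_ : c = ord0) ?ltnn //; apply: val_inj.
  have c1 : c.-1 < n.+1 by have := ltn_ord c; lia.
  have p1 : ((y^-1)%g ord0).+1 < n.+1 by apply: leq_ltn_trans (ltn_ord ((y^-1)%g c)).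
  have /spannedP[_ [b /= pb bc]] : spanned y (Ordinal c1) (Ordinal p1).
    apply: tight_s => /=; first by lia.
    apply/spannedP; split.
      by exists (lift ord0 ord0); rewrite ?wS !lift0 ?val_lift /=; lia.
    exists (lift ord0 ((y^-1)%g c)); first by rewrite !lift0 /=.
    by rewrite wS permKV !lift0 val_lift /=; lia.
  have := IHm (y b); rewrite permK; lia.
apply: reduce => a b ab yab; rewrite leqNgt; apply/negP => /early; rewrite permK => bp.
have := decV (y a) (y b) yab; rewrite !permK => /(_ ab).
by rewrite ltnNge bp.
Qed.

(** * Lehmer codes *)

Lemma cnt_lift n (a : 'I_n.+1) (z : 'S_n) p m :
  cnt (lift_perm ord0 a z) p.+1 m = (a < m) + cnt z p (m - (a < m)).
Proof.
rewrite /cnt big_ord_recl lift_perm_id; congr (_ + _); apply: eq_bigr => l _.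
by rewrite lift_perm_lift lift0 val_lift; case: (ltnP a m); lia.
Qed.

Lemma cnt0 n (w : 'S_n) m : cnt w 0 m = 0.
Proof. by rewrite /cnt big1. Qed.

Lemma sum_perm_itv n (v : 'S_n) a b :
  \sum_(l < n) (a <= v l < b) = \sum_(l < n) (a <= l < b).
Proof. by rewrite [RHS](reindex_inj (@perm_inj _ v)). Qed.

Lemma cnt_splitr n (v : 'S_n) p a b : a <= b ->
  cnt v p b = cnt v p a + \sum_(l < n) ((l < p) && (a <= v l < b)).
Proof. by move=> ab; rewrite /cnt -big_split; apply: eq_bigr => l _ /=; lia. Qed.

Lemma cnt_pred n (v : 'S_n) p m : cnt v p m <= (cnt v p m.-1).+1.
Proof.
case: m => // m; rewrite (@cnt_splitr _ _ _ m) ?leqnSn //= -[leqRHS]addn1 leq_add2l.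
apply: (@leq_trans (\sum_(l < n) (m <= v l < m.+1))).
  by apply: leq_sum => l _; lia.
rewrite sum_perm_itv; have [nm|mn] := leqP n m.
  by rewrite big1 // => l _; have := ltn_ord l; lia.
rewrite (bigD1 (Ordinal mn)) //= big1 ?addn0; first by lia.
by move=> l; rewrite -val_eqE /=; lia.
Qed.

Lemma bruhat_lift n (a b : 'I_n.+1) (y z : 'S_n) : a <= b -> bruhat y z ->
  bruhat (lift_perm ord0 a y) (lift_perm ord0 b z).
Proof.
move=> ab /bruhatP yz; apply/bruhatP => -[|p] m; first by rewrite !cnt0.
rewrite !cnt_lift.
apply: (@leq_trans ((b < m) + cnt y p (m - (b < m)))); first by rewrite leq_add2l yz.
have [bm|mb] := ltnP b m; first by rewrite (leq_ltn_trans ab bm).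
by rewrite subn0 add0n; case: ltnP => am; rewrite ?subn0 // subn1 add1n cnt_pred.
Qed.

(** Deleting the first letter compares the counts for [m >= q] directly. For [m < q], once a value
    below [m] has occurred in [y], all values in [[m, q[] have occurred by [initial_dec], so the
    inequality at [q] descends to [m]. *)
Lemma bruhat_lift_iff n (a q : 'I_n.+1) (y z : 'S_n) :
  initial_dec (lift_perm ord0 q y) ->
  bruhat (lift_perm ord0 a z) (lift_perm ord0 q y) = (a <= q) && bruhat z y.
Proof.
move=> dec; apply/idP/andP => [/bruhatP H|[aq zy]]; last exact: bruhat_lift.
have aq : a <= q.
  by have := H 1 q.+1; rewrite !cnt_lift !cnt0 !addn0 ltnSn ltnS; case: (a <= q).
split=> //; apply/bruhatP.
have high p m : q <= m -> cnt y p m <= cnt z p m.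
  move=> qm; have := H p.+1 m.+1; rewrite !cnt_lift !ltnS qm (leq_trans aq qm).
  by rewrite subn1 leq_add2l.
move=> p m; have [/high//|mq] := leqP q m.
have [->//|c_gt0] := posnP (cnt y p m).
have [l [lp ylm]] : exists l : 'I_n, l < p /\ y l < m.
  have : cnt y p m != 0 by rewrite -lt0n.
  rewrite sum_nat_eq0 => /forallPn[l]; rewrite /= eqb0 negbK => /andP[lp ylm].
  by exists l.
have := high p q (leqnn q); rewrite !(@cnt_splitr _ _ p m q (ltnW mq)).
have -> : \sum_(i < n) ((i < p) && (m <= y i < q)) = \sum_(i < n) (m <= y i < q).
  apply: eq_bigr => i _; have [//|pi] := ltnP i p.
  have [/andP[myi yiq]|//] := boolP (m <= y i < q).
  have := dec (lift ord0 l) (lift ord0 i).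
  by rewrite !lift_perm_lift lift_perm_id !lift0 !val_lift; lia.
have : \sum_(i < n) ((i < p) && (m <= z i < q)) <= \sum_(i < n) (m <= z i < q).
  by apply: leq_sum => i _; lia.
by rewrite !sum_perm_itv; lia.
Qed.

Lemma lift_perm_inj n (i a b : 'I_n.+1) (y z : 'S_n) :
  lift_perm i a y = lift_perm i b z -> a = b /\ y = z.
Proof.
move=> E; have ab : a = b by rewrite -(lift_perm_id i a y) E lift_perm_id.
split=> //; rewrite -{b}ab in E; apply/permP => l; apply: (@lift_inj _ a).
by rewrite -!(lift_perm_lift i) E.
Qed.

(** Lehmer codes with coordinates in a list bounded by [s], so that a chain is adjoined by consing,
    without dependent functions. *)
Definition seq_code (T : Type) (P : T -> Prop) (le : rel T) (rk : T -> nat)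
    (s : seq nat) (L : seq nat -> T) : Prop :=
  [/\ forall x y, all2 ltn x s -> all2 ltn y s -> L x = L y -> x = y,
      forall v, P v <-> exists2 x, all2 ltn x s & L x = v,
      forall x y, all2 ltn x s -> all2 ltn y s -> all2 leq x y -> le (L x) (L y)
    & forall x, all2 ltn x s -> rk (L x) = sumn x].

Lemma all2_nthP (T S : Type) (x0 : T) (y0 : S) (r : T -> S -> bool) s t :
  reflect (size s = size t /\ forall i, i < size s -> r (nth x0 s i) (nth y0 t i))
          (all2 r s t).
Proof.
elim: s t => [|x s IH] [|y t] /=; try by constructor; case.
  by constructor.
apply: (iffP andP) => [[xy /IH[-> H]]|[[E] H]]; first by split=> // -[|i] //= /H.
by split; [exact: (H 0)|apply/IH; split=> // i; exact: (H i.+1)].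
Qed.

Lemma seq_code_lehmer (T : finType) (P : {set T}) (le : rel T) (rk : T -> nat) s L :
  seq_code (fun v => v \in P) le rk s L -> admits_lehmer_code P le rk.
Proof.
case=> inj im mono rkE.
pose a (i : 'I_(size s)) := nth 0 s i.
pose tos (x : {dffun forall i : 'I_(size s), 'I_(a i)}) : seq nat :=
  [seq (x i : nat) | i <- enum 'I_(size s)].
have size_tos x : size (tos x) = size s by rewrite size_map size_enum_ord.
have nth_tos x (i : 'I_(size s)) : nth 0 (tos x) i = x i.
  by rewrite (nth_map i) ?size_enum_ord // nth_ord_enum.
have tosP x : all2 ltn (tos x) s.
  apply/(all2_nthP 0 0); split; rewrite size_tos // => i lt_i.
  by rewrite (nth_tos x (Ordinal lt_i)); exact: ltn_ord.
exists (size s), a, (L \o tos); split.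
- move=> x y /= /(inj _ _ (tosP x) (tosP y)) E; apply/ffunP => i.
  by apply: val_inj; rewrite /= -!nth_tos E.
- apply/setP => v; apply/imsetP/idP => [[x _ ->]|/im[x xs <-]].
    by apply/im; exists (tos x).
  have /(all2_nthP 0 0)[sz lt_x] := xs; rewrite sz in lt_x.
  pose y : {dffun forall i : 'I_(size s), 'I_(a i)} :=
    [ffun i : 'I_(size s) => @Ordinal (a i) (nth 0 x i) (lt_x i (ltn_ord i))].
  exists y; rewrite ?inE //=; congr L; apply: (@eq_from_nth _ 0); rewrite ?size_tos // sz => i lt_i.
  by rewrite (nth_tos y (Ordinal lt_i)) ffunE.
- move=> x y xy; apply: mono => //; apply/(all2_nthP 0 0); rewrite !size_tos; split=> // i lt_i.
  by rewrite (nth_tos x (Ordinal lt_i)) (nth_tos y (Ordinal lt_i)); apply: xy.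
- move=> x; rewrite /= rkE // sumnE big_map big_enum /=.
  by apply: eq_bigr.
Qed.

(** Inserting a letter [a <= q] contributes a chain of [q.+1] elements. On lists within the bounds
    neither [head 0] nor [inord] takes its default. *)
Lemma seq_code_cons (T T' : Type) (P : T -> Prop) (P' : T' -> Prop) (le : rel T)
    (le' : rel T') rk rk' s L n (q : 'I_n.+1) (I : 'I_n.+1 -> T -> T') :
  (forall a b y z, I a y = I b z -> a = b /\ y = z) ->
  (forall v, P' v <-> exists (a : 'I_n.+1) z, [/\ a <= q, P z & I a z = v]) ->
  (forall (a b : 'I_n.+1) y z, a <= b -> le y z -> le' (I a y) (I b z)) ->
  (forall a z, rk' (I a z) = a + rk z) ->
  seq_code P le rk s L ->
  seq_code P' le' rk' (q.+1 :: s) (fun x => I (inord (head 0 x)) (L (behead x))).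
Proof.
move=> Iinj IP Imono Irk [inj im mono rkE].
have qn := ltn_ord q.
split.
- case=> [|a x] [|b y] //= /andP[aq xs] /andP[bq ys] /Iinj[E /inj ->] //.
  by congr (_ :: _); have := congr1 val E; rewrite /= !inordK //; lia.
- move=> v; split=> [/IP[a [z [aq /im[x xs <-] <-]]]|[[|a x] //= /andP[aq xs] <-]].
    by exists ((a : nat) :: x); rewrite /= ?inord_val // ltnS aq.
  apply/IP; exists (inord a), (L x); split=> //; last by apply/im; exists x.
  by rewrite inordK; lia.
- case=> [|a x] [|b y] //= /andP[aq xs] /andP[bq ys] /andP[ab xy].
  by apply: Imono; [rewrite !inordK //; lia|exact: mono].
- case=> [|a x] //= /andP[aq xs]; rewrite Irk rkE // inordK //; lia.
Qed.

Lemma lift_mono n (q : 'I_n.+1) (a b : 'I_n) : (lift q a < lift q b) = (a < b).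
Proof. by rewrite !val_lift; lia. Qed.

Lemma tail_inc_lift n k (i a : 'I_n.+1) (z : 'S_n) : i <= k ->
  tail_inc k.+1 (lift_perm i a z) <-> tail_inc k z.
Proof.
move=> ik; split=> H l l' kl ll'.
  by rewrite -(lift_mono a) -!(lift_perm_lift i); apply: H; rewrite ?lift_mono // val_lift; lia.
move: kl ll'; case: (unliftP i l) => [m|] ->; last by lia.
case: (unliftP i l') => [m'|] ->; last by rewrite val_lift; lia.
rewrite !lift_perm_lift !lift_mono val_lift => km mm'; apply: H => //; lia.
Qed.

Lemma tail_dec_lift n k (i a : 'I_n.+1) (z : 'S_n) : i <= k ->
  tail_dec k.+1 (lift_perm i a z) -> tail_dec k z.
Proof.
move=> ik H l l' kl ll'.
by rewrite -(lift_mono a) -!(lift_perm_lift i); apply: H; rewrite ?lift_mono // val_lift; lia.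
Qed.

Lemma seq_code_1 n (P : 'S_n -> Prop) : (forall v, P v <-> v = 1%g) ->
  seq_code P (@bruhat n) (@ninv n) [::] (fun=> 1%g).
Proof.
move=> P1; split=> [[|??] [|??] //|v||[|??] //= _]; last exact: ninv1.
  by rewrite P1; split=> [->|[x _ <-]] //; exists [::].
by move=> x y _ _ _; exact: connect0.
Qed.

Lemma seq_code_exists n k (om : 'S_n) : tail_dec k om -> nspanned om = ninv om ->
  exists s L, seq_code (fun v => tail_inc k v /\ bruhat v om) (@bruhat n) (@ninv n) s L.
Proof.
elim: n k om => [|n IH] k om dec tight.
  exists [::], (fun=> 1%g); apply: seq_code_1 => v.
  split=> [_|->]; first by apply/permP; case.
  by split=> [[] //|]; apply/bruhatP; exact: dle_1.
case: k dec => [|k] dec.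
  exists [::], (fun=> 1%g); apply: seq_code_1 => v.
  split=> [[/tail_inc0]|->] //; split; last by apply/bruhatP; exact: dle_1.
  by move=> a b _; rewrite !perm1.
have [qp|pq] := leqP (om ord0) ((om^-1)%g ord0).
  have idec := initial_dec_smooth tight qp.
  have [y Eom] := lift_permP om ord0; move: (om ord0) Eom qp => q Eom qp.
  rewrite {om}Eom in dec tight qp idec *.
  have [tight_y _] := nspanned_tight tight qp.
  have [s [L sL]] := IH k y (@tail_dec_lift n k ord0 q y isT dec) tight_y.
  exists (q.+1 :: s); eexists; apply: (seq_code_cons (I := lift_perm ord0)) sL.
  - by move=> a b u v; exact: lift_perm_inj.
  - move=> v; split=> [[vinc vom]|[a [z [aq [zinc zy] <-]]]].
      have [z Ev] := lift_permP v ord0; exists (v ord0), z.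
      move: (v ord0) Ev vinc vom => a -> /(@tail_inc_lift n k ord0 a z isT) zinc.
      by rewrite bruhat_lift_iff // => /andP[].
    by rewrite bruhat_lift_iff // aq zy; split=> //; apply/tail_inc_lift.
  - exact: bruhat_lift.
  - exact: ninv_lift.
(* In a decreasing tail the value 0 could only come last, but its position is smaller than the value
   [om ord0]. Hence removing it only shifts the tail. *)
have pk : (om^-1)%g ord0 <= k.
  rewrite leqNgt; apply/negP => kp; have pn := ltn_ord (om ord0).
  have := @dec ((om^-1)%g ord0) ord_max kp; rewrite permKV /=; lia.
have idec : initial_dec (om^-1)%g.
  by apply: initial_dec_smooth; rewrite ?nspannedV ?invV ?invgK // ltnW.
(* Deleting the value 0 from [om] is deleting the first letter from its inverse, which has the
   property [initial_dec]. *)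
have [y Eom] := lift_permP om^-1%g ord0.
have Eom' : om = lift_perm ((om^-1)%g ord0) ord0 y^-1%g.
  by rewrite -{1}[om]invgK {1}Eom lift_permV.
have qp : (om^-1)%g ord0 <= om ord0 by exact: ltnW.
move: ((om^-1)%g ord0) Eom Eom' pk qp {pq} => p Eom Eom' pk qp.
have tight_y : nspanned y = ninv y.
  by case: (@nspanned_tight n p y); rewrite -?Eom ?invgK // nspannedV invV.
rewrite {}Eom' in dec.
have [s [L sL]] := IH k y^-1%g (tail_dec_lift pk dec)
  (etrans (nspannedV y) (etrans tight_y (esym (invV y)))).
exists (p.+1 :: s); eexists; apply: (seq_code_cons (I := fun a => lift_perm a ord0)) sL.
- move=> a b u v /(congr1 (fun u => u^-1)%g); rewrite !lift_permV => /lift_perm_inj[-> /invg_inj].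
  by split.
- have E a (z : 'S_n) : bruhat (lift_perm a ord0 z) om = (a <= p) && bruhat z y^-1%g.
    rewrite -bruhatV lift_permV Eom bruhat_lift_iff; last by rewrite -Eom.
    by rewrite -[in RHS]bruhatV invgK.
  move=> v; split=> [[vinc vom]|[a [z [aq [zinc zy] <-]]]].
    have [z Ev] := lift_permP v^-1%g ord0; exists ((v^-1)%g ord0), z^-1%g.
    move: ((v^-1)%g ord0) Ev => a /(congr1 (fun u => u^-1)%g); rewrite invgK lift_permV => Ev.
    move: vom vinc; rewrite Ev E => /andP[ap zy] /tail_inc_lift zinc.
    by split=> //; split=> //; apply: zinc; apply: leq_trans pk.
  by rewrite E aq zy; split=> //; apply/tail_inc_lift => //; apply: leq_trans pk.
- move=> a b u v ab uv; rewrite -bruhatV !lift_permV; apply: bruhat_lift => //.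
  by rewrite bruhatV.
- by move=> a z; rewrite -invV lift_permV ninv_lift invV.
Qed.

Theorem theorem5p3 (n j : nat) (hj : 1 <= j <= n) (w : 'S_n)
    (wJ : w \in min_reps (simple_from n j))
    (w_smooth : rationally_smooth (simple_from n j) w) :
  admits_lehmer_code (lower_interval (simple_from n j) w) (@bruhat n) (@len n).
Proof.
case: j hj wJ w_smooth => // k _ wJ smooth.
have winc := elimT (min_repsP k w) wJ.
(* [ninv <= nspanned <= nedges] at the identity, and smoothness makes the two ends equal. *)
have tight : nspanned (tail_rev n k * w^-1)%g = ninv (tail_rev n k * w^-1)%g.
  by apply/eqP; rewrite eqn_leq nspanned_ge andbT -(smooth_nedges wJ smooth) nspanned_le.
have [s [L [inj im mono rkE]]] := seq_code_exists (tail_rev_dec winc) tight.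
(* The code was built on inverses, the one-line words; inversion preserves order and length. *)
apply: (@seq_code_lehmer _ _ _ _ s (fun x => (L x)^-1%g)); split.
- by move=> x y xs ys /invg_inj; exact: inj.
- move=> v; rewrite in_set; have E : bruhat v w = bruhat v^-1%g w^-1%g by rewrite bruhatV.
  split=> [/andP[/min_repsP vinc vw]|[x xs <-]].
    have /im[x xs Lx] : tail_inc k v^-1%g /\ bruhat v^-1%g (tail_rev n k * w^-1)%g.
      by rewrite bruhat_tail_rev // -E.
    by exists x; rewrite ?Lx ?invgK.
  have [] : tail_inc k (L x) /\ bruhat (L x) (tail_rev n k * w^-1)%g by apply/im; exists x.
  move=> Linc; rewrite bruhat_tail_rev // -bruhatV invgK => ->; rewrite andbT.
  by apply/min_repsP; rewrite invgK.
- by move=> x y xs ys xy; rewrite bruhatV mono.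
- by move=> x xs; rewrite len_inv invV rkE.
Qed.
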